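(* Let $q\in\mathbb{C}\setminus\{0\}$ be not a root of unity, and let $V_q$ be the $q$-analog Virasoro-like algebra. Then $\Delta(V_q)=\mathrm{span}_{\mathbb{C}}\{\mathrm{id}\}$.
   Context: ''Not a root of unity'' means $q^t\neq 1$ for all positive integers $t$. The $q$-analog Virasoro-like algebra $V_q$ is the complex Lie algebra with basis $\{L_{\mathbf m}\mid \mathbf m\in\mathbb{Z}^2\setminus\{\mathbf 0\}\}$ and bracket $[L_{\mathbf m},L_{\mathbf n}]=\lambda(\mathbf m,\mathbf n)L_{\mathbf m+\mathbf n}$ for $\mathbf m=(m_1,m_2),\mathbf n=(n_1,n_2)\in\mathbb{Z}^2\setminus\{\mathbf 0\}$, where $\lambda(\mathbf m,\mathbf n)=q^{m_2n_1}-q^{m_1n_2}$, with the convention $L_{\mathbf 0}=0$. A linear map $\varphi:L\to L$ on a Lie algebra $L$ is a $\frac12$-derivation if $\varphi([x,y])=\frac12\left([\varphi(x),y]+[x,\varphi(y)]\right)$ for all $x,y\in L$; $\Delta(L)$ denotes the vector space of all $\frac12$-derivations of $L$. *)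

(* Defs.v *)
From HB Require Import structures.
From mathcomp Require Import all_boot all_order all_algebra.
From mathcomp Require Import finmap complex ring.
From mathcomp.multinomials Require Import monalg.
From mathcomp Require Import classical_sets functions reals.

Set Implicit Arguments.
Unset Strict Implicit.
Unset Printing Implicit Defensive.

Import GRing.Theory Num.Theory.

Local Open Scope ring_scope.

HB.mixin Record Lmodule_isLie (K : fieldType) V of GRing.Lmodule K V := {
  lie : V -> V -> V;
  lie_linearl : forall y, linear (lie^~ y);
  lie_linearr : forall x, linear (lie x);
  liexx : forall x, lie x x = 0;
  lie_jacobi : forall x y z,
    lie x (lie y z) + lie y (lie z x) + lie z (lie x y) = 0
}.

#[short(type="lieAlgType")]
HB.structure Definition LieAlgebra (K : fieldType) :=
  {V of GRing.Lmodule K V & Lmodule_isLie K V}.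

Definition half_derivation (K : fieldType) (V : lieAlgType K) (phi : V -> V) :=
  linear phi /\
  forall x y : V, phi (lie x y) = 2%:R^-1 *: (lie (phi x) y + lie x (phi y)).

Definition Delta (K : fieldType) (V : lieAlgType K) : set (V -> V) :=
  [set phi | half_derivation phi]%classic.
Arguments Delta {K} V.

Definition lspan (K : fieldType) (V : lmodType K) (S : set V) : set V :=
  [set v | exists (n : nat) (c : 'I_n -> K) (u : 'I_n -> V),
     (forall i, S (u i)) /\ v = \sum_i c i *: u i]%classic.

(* The basis of V_q is indexed by the nonzero vectors of Z^2. *)
Definition idx : Type := {m : int * int | m != 0}.
HB.instance Definition _ := Choice.on idx.

Section Extension.
Variables (K : fieldType) (I : choiceType) (V : lmodType K).
Implicit Types (f : I -> V) (x : {malg K[I]}).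

Definition lext f x : V := \sum_(k <- msupp x) x@_k *: f k.

Lemma lextEw f x (d : {fset I}) : (msupp x `<=` d)%fset ->
  lext f x = \sum_(k <- d) x@_k *: f k.
Proof.
move=> le; apply/big_fset_incl => // k _ /mcoeff_outdom ->.
by rewrite scale0r.
Qed.

Lemma lext_linear f : linear (lext f).
Proof.
move=> a x y; pose d := (msupp (a *: x + y) `|` (msupp x `|` msupp y))%fset.
rewrite !(@lextEw _ _ d); first last.
- exact: fsubsetUl.
- by rewrite fsubsetU // fsubsetUl orbT.
- by rewrite fsubsetU // fsubsetUr orbT.
rewrite scaler_sumr -big_split /=; apply: eq_bigr => k _.
by rewrite mcoeffD mcoeffZ scalerDl scalerA.
Qed.

Lemma lextU f k : lext f << k >> = f k.
Proof.
rewrite (lextEw f (msuppU_le (k := k) (x := 1))) big_seq_fset1 mcoeffUU.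
by rewrite scale1r.
Qed.

Lemma eq_lext f g x : f =1 g -> lext f x = lext g x.
Proof. by move=> fg; apply: eq_bigr => k _; rewrite fg. Qed.

Lemma linear_lextE (g : {malg K[I]} -> V) x :
  linear g -> g x = lext (fun k => g << k >>) x.
Proof.
move=> lg.
pose gL := GRing.isLinear.Build K {malg K[I]} V *:%R g lg.
pose G : {linear {malg K[I]} -> V} := HB.pack g gL.
rewrite -[g]/(G : _ -> _) {1}[x]monalgE raddf_sum; apply: eq_bigr => k _.
rewrite -linearZ; congr (G _); apply/malgP => j.
by rewrite mcoeffZ !mcoeffU mulrnAr mulr1.
Qed.

Lemma linear_ext0 (g : {malg K[I]} -> V) x :
  linear g -> (forall k, g << k >> = 0) -> g x = 0.
Proof.
move=> lg g0; rewrite (linear_lextE _ lg) /lext big1 // => k _.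
by rewrite g0 scaler0.
Qed.

End Extension.

Definition lambda (K : fieldType) (q : K) (m n : int * int) : K :=
  q ^ (m.2 * n.1) - q ^ (m.1 * n.2).

(* The hypothesis q != 0 is what makes the bracket satisfy Jacobi. *)
Definition Vq (K : numFieldType) (q : K) (q0 : q != 0) : Type := {malg K[idx]}.

Section QVirasoroLike.
Variables (K : numFieldType) (q : K) (q0 : q != 0).

HB.instance Definition _ := GRing.Lmodule.copy (Vq q0) {malg K[idx]}.

(* Total in m, with the convention L 0 = 0. *)
Definition L (m : int * int) : Vq q0 :=
  if insub m is Some k then << (k : idx) >> else 0.

Definition bracket (x y : Vq q0) : Vq q0 :=
  lext (fun i : idx =>
    lext (fun j : idx => lambda q (\val i) (\val j) *: L (\val i + \val j)) y) x.

Lemma L0 : L 0 = 0.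
Proof. by rewrite /L insubF // eqxx. Qed.

Lemma L_val (k : idx) : L (\val k) = << k >>.
Proof. by rewrite /L valK. Qed.

Lemma bracket_linearl y : linear (bracket^~ y).
Proof. exact: lext_linear. Qed.

Lemma bracket_linearr x : linear (bracket x).
Proof.
move=> a y z; rewrite /bracket {1}/lext scaler_sumr -big_split /=.
by apply: eq_bigr => i _; rewrite lext_linear scalerDr !scalerA mulrC.
Qed.

Lemma lambda0l n : lambda q 0 n = 0.
Proof. by rewrite /lambda !mul0r subrr. Qed.

Lemma lambda0r m : lambda q m 0 = 0.
Proof. by rewrite /lambda !mulr0 subrr. Qed.

Lemma bracket0l y : bracket 0 y = 0.
Proof. by rewrite /bracket /lext msupp0 big_seq_fset0. Qed.

Lemma bracket0r x : bracket x 0 = 0.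
Proof.
by rewrite /bracket /lext big1 // => i _; rewrite msupp0 big_seq_fset0 scaler0.
Qed.

Lemma bracketLL m n : bracket (L m) (L n) = lambda q m n *: L (m + n).
Proof.
have [->|m0] := eqVneq m 0; first by rewrite L0 bracket0l lambda0l scale0r.
have [->|n0] := eqVneq n 0; first by rewrite L0 bracket0r lambda0r scale0r.
rewrite -[m]/(\val (exist _ m m0 : idx)) -[n]/(\val (exist _ n n0 : idx)).
by rewrite !L_val /bracket !lextU.
Qed.

Lemma bracketDl x x' y : bracket (x + x') y = bracket x y + bracket x' y.
Proof. by have := bracket_linearl y 1 x x'; rewrite !scale1r. Qed.

Lemma bracketDr x y y' : bracket x (y + y') = bracket x y + bracket x y'.
Proof. by have := bracket_linearr x 1 y y'; rewrite !scale1r. Qed.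

Lemma bracketZl a x y : bracket (a *: x) y = a *: bracket x y.
Proof.
by have := bracket_linearl y a x 0; rewrite !addr0 bracket0l addr0.
Qed.

Lemma bracketZr a x y : bracket x (a *: y) = a *: bracket x y.
Proof.
by have := bracket_linearr x a y 0; rewrite !addr0 bracket0r addr0.
Qed.

Let bracketE := (bracketDl, bracketDr, bracketZl, bracketZr).

Lemma bracketC x y : bracket x y + bracket y x = 0.
Proof.
pose f u : Vq q0 := bracket u y + bracket y u.
apply: (@linear_ext0 _ _ _ f x) => [a u v|i].
  by rewrite /f !bracketE scalerDr addrACA.
pose g u : Vq q0 := bracket << i >> u + bracket u << i >>.
apply: (@linear_ext0 _ _ _ g y) => [a u v|j].
  by rewrite /g !bracketE scalerDr addrACA.
rewrite /g -!L_val !bracketLL (addrC (\val j)) -scalerDl.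
suff -> : lambda q (\val i) (\val j) + lambda q (\val j) (\val i) = 0.
  by rewrite scale0r.
by rewrite /lambda (mulrC (\val i).1) (mulrC (\val i).2) addrC subrKA subrr.
Qed.

Lemma bracketxx x : bracket x x = 0.
Proof.
have /eqP := bracketC x x.
rewrite -mulr2n -scaler_nat scaler_eq0 pnatr_eq0 /=; exact/eqP.
Qed.

Lemma lambda_jacobi m n p :
  lambda q n p * lambda q m (n + p) + lambda q p m * lambda q n (p + m)
    + lambda q m n * lambda q p (m + n) = 0.
Proof.
rewrite /lambda /= !mulrDr !expfzDr //.
rewrite (mulrC p.2 m.1) (mulrC p.1 m.2) (mulrC p.2 n.1) (mulrC p.1 n.2).
rewrite (mulrC n.2 m.1) (mulrC n.1 m.2).
by ring.
Qed.

Lemma bracket_jacobi x y z :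
  bracket x (bracket y z) + bracket y (bracket z x) + bracket z (bracket x y)
    = 0.
Proof.
have shuffle (a : K) (u1 u2 u3 v1 v2 v3 : Vq q0) :
    (a *: u1 + v1) + (a *: u2 + v2) + (a *: u3 + v3)
      = a *: (u1 + u2 + u3) + (v1 + v2 + v3).
  by rewrite !scalerDr (addrACA (a *: u1) v1) [LHS]addrACA.
pose f u : Vq q0 :=
  bracket u (bracket y z) + bracket y (bracket z u) + bracket z (bracket u y).
apply: (@linear_ext0 _ _ _ f x) => [a u v|i].
  by rewrite /f !bracketE shuffle.
pose g u : Vq q0 :=
  bracket << i >> (bracket u z) + bracket u (bracket z << i >>)
    + bracket z (bracket << i >> u).
apply: (@linear_ext0 _ _ _ g y) => [a u v|j].
  by rewrite /g !bracketE shuffle.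
pose h u : Vq q0 :=
  bracket << i >> (bracket << j >> u) + bracket << j >> (bracket u << i >>)
    + bracket u (bracket << i >> << j >>).
apply: (@linear_ext0 _ _ _ h z) => [a u v|k].
  by rewrite /h !bracketE shuffle.
rewrite /h -!L_val; move: (\val i) (\val j) (\val k) => m n p.
rewrite !(bracketLL, bracketZr) !scalerA.
rewrite (addrC p m) (addrCA n m p) (addrCA p m n) (addrC p n) -!scalerDl.
by rewrite (addrC m p) lambda_jacobi scale0r.
Qed.

HB.instance Definition _ := Lmodule_isLie.Build K (Vq q0)
  bracket_linearl bracket_linearr bracketxx bracket_jacobi.

Lemma lieLL (m n : int * int) :
  lie (L m) (L n) = lambda q m n *: L (m + n).
Proof. exact: bracketLL. Qed.

End QVirasoroLike.

(* Main.v *)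
Require Import Defs.
From mathcomp Require Import all_boot all_order all_algebra.
From mathcomp Require Import complex.
From mathcomp Require Import classical_sets functions reals.
From mathcomp Require Import boolp ring zify.
From mathcomp.multinomials Require Import monalg.
Set Implicit Arguments.
Unset Strict Implicit.
Unset Printing Implicit Defensive.
Import GRing.Theory Num.Theory.
Local Open Scope ring_scope.
Local Open Scope classical_set_scope.
Local Open Scope complex_scope.

(** The algebra is graded by Z^2, so a half-derivation [phi] is studied through
its homogeneous components: for a fixed shift [k], let [c m] be the coefficient
of [phi (L m)] at [L (m + k)].  Comparing coefficients in
[phi (lie (L m) (L n))] shows that [c] satisfies the functional equation
[half_der_symbol k c].  As [q] is not a root of unity, [lambda q m n] vanishes
exactly when [m] and [n] are parallel, and this settles the equation.

Shift [k = 0]: the equation says that [c (m + n)] is the mean of [c m] and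
[c n] for independent [m] and [n].  Combining it with the decomposition
[m = (m + n) + (- n)] gives [3 c m = c n + 2 c (- n)], so [c] is constant off
the line of [n].  Two nonzero vectors always avoid a common line, hence [c] is
constant ([symbol_shift0]).

Shift [k != 0]: since [L 0 = 0], [c (- k) = 0].  Feeding [n = - k] and [n = k]
into the equation gives, for [m] off the line of [k], the two relations
[c (m + k) = 2 q^(k1 k2) c m] and
[3 q^(k1 k2) c m = c k (q^(m2 k1) + q^(m1 k2))].  Under [m -> m + k] the right
side of the second is multiplied by [q^(k1 k2)] and the left side by twice
that, so [c] vanishes off the line of [k].  A vector on that line is a sum of
two independent vectors off it, and [c] vanishes there as well
([symbol_shift_neq0]).

Hence [phi (L m) = a *: L m] with [a] independent of [m]. *)

(** * Parallel vectors of the lattice *)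

Definition det2 (m n : int * int) : int := m.2 * n.1 - m.1 * n.2.

Lemma det2C m n : det2 n m = - det2 m n.
Proof. by rewrite /det2; lia. Qed.

Lemma det2Nr m n : det2 m (- n) = - det2 m n.
Proof. by rewrite /det2 /=; lia. Qed.

Lemma det2xx m : det2 m m = 0.
Proof. by rewrite /det2; lia. Qed.

Lemma det2Dl m n p : det2 (m + n) p = det2 m p + det2 n p.
Proof. by rewrite /det2 /=; lia. Qed.

(** Each of the two lines contains at most one of the vectors [(1, 0)],
[(1, 1)], [(1, 2)], so one of the three is on neither. *)
Lemma exists_off_two_lines (m p : int * int) : m != 0 -> p != 0 ->
  exists n, det2 m n != 0 /\ det2 p n != 0.
Proof.
case: m p => [m1 m2] [p1 p2].
rewrite -!pair_eqE /= !negb_and => m0 p0.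
have [t /= ht] : exists t : int, (m2 - m1 * t != 0) && (p2 - p1 * t != 0).
  have [?|] := boolP ((m2 - m1 * 0 != 0) && (p2 - p1 * 0 != 0)).
    by exists 0.
  have [?|] := boolP ((m2 - m1 * 1 != 0) && (p2 - p1 * 1 != 0)).
    by exists 1.
  by move=> ? ?; exists 2; lia.
by exists (1, t); rewrite /det2 /= !mulr1; exact/andP.
Qed.

(** * The functional equation of a homogeneous component *)

Section Symbol.
Variables (K : numFieldType) (q : K).
Hypothesis q0 : q != 0.
Hypothesis q_nroot : forall t : nat, (0 < t)%N -> q ^+ t != 1.

Lemma exprz_eq1_nroot (z : int) : (q ^ z == 1) = (z == 0).
Proof.
case: z => [[|t]|t]; first by rewrite eqxx.
  by rewrite -[LHS]/(q ^+ t.+1 == 1); exact/negbTE/q_nroot.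
by rewrite -[LHS]/((q ^+ t.+1)^-1 == 1) invr_eq1; exact/negbTE/q_nroot.
Qed.

(** [lambda q m n] is a power of [q] times [q ^ det2 m n - 1], which is where
the absence of roots of unity enters. *)
Lemma lambda_eq0 m n : (lambda q m n == 0) = (det2 m n == 0).
Proof.
rewrite /lambda -{1}(subrK (m.1 * n.2) (m.2 * n.1)) expfzDr //.
rewrite -[X in _ - X]mul1r -mulrBl mulf_eq0 subr_eq0 exprz_eq1_nroot.
by rewrite (negbTE (expfz_neq0 _ q0)) orbF.
Qed.

(** The condition for the map [L m |-> c m *: L (m + k)] to be a half-derivation,
when [c] vanishes at [0] and at [- k], in line with [L 0 = 0]. *)
Definition half_der_symbol (k : int * int) (c : int * int -> K) :=
  forall m n, lambda q m n * c (m + n) =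
    2%:R^-1 * (lambda q (m + k) n * c m + lambda q m (n + k) * c n).

(** Independence of [m] and [n] makes [c (m + n)] the mean of [c m] and [c n];
the value [c m] is then determined by [n] alone, so that any two nonzero
vectors are compared through a third one independent of both. *)
Lemma symbol_shift0 c : half_der_symbol 0 c ->
  forall m n, m != 0 -> n != 0 -> c m = c n.
Proof.
move=> cP.
have mean m n : det2 m n != 0 -> 2 * c (m + n) = c m + c n.
  rewrite -lambda_eq0 => l0; apply: (mulfI l0).
  rewrite mulrCA cP !addr0 -mulrDr mulVKf //.
  by rewrite pnatr_eq0.
have off m n : det2 m n != 0 -> 3 * c m = c n + 2 * c (- n).
  move=> mn; have := mean (m + n) (- n).
  rewrite addrK det2Nr det2Dl det2xx addr0 oppr_eq0 => /(_ mn) h.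
  have -> : 3 * c m = 2 * (2 * c m) - c m by ring.
  by rewrite h mulrDr (mean _ _ mn); ring.
move=> m p m0 p0; have [n [mn pn]] := exists_off_two_lines m0 p0.
have n3 : 3 != 0 :> K by rewrite pnatr_eq0.
by apply: (mulfI n3); rewrite (off _ _ mn) (off _ _ pn).
Qed.

Lemma lambda_shiftl m k : lambda q (m + k) k = q ^ (k.1 * k.2) * lambda q m k.
Proof.
by rewrite /lambda /= !mulrDl !expfzDr // (mulrC k.2); ring.
Qed.

Lemma lambda_shiftr m k :
  lambda q (m + k) (- k) = (q ^ (k.1 * k.2))^-1 * lambda q m (- k).
Proof.
rewrite /lambda /= !mulrDl !expfzDr // !mulrN (mulrC k.2) invr_expz.
by ring.
Qed.

Lemma lambda_double m k :
  lambda q m (k + k) = (q ^ (m.2 * k.1) + q ^ (m.1 * k.2)) * lambda q m k.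
Proof. by rewrite /lambda /= !mulrDr !expfzDr //; ring. Qed.

(** Let [Q = q ^ (k1 k2)] and [S m = q ^ (m2 k1) + q ^ (m1 k2)].  Off the line of
[k], the equation at [n = - k] says that translating by [k] multiplies [c] by
[2 * Q].  Together with it, the equation at [n = k] makes [c] proportional to
[S], which translation multiplies by [Q] only; hence [c] is zero there.  The
hypothesis [c (- k) = 0] reflects [L 0 = 0]. *)
Lemma symbol_shift_neq0 k c : k != 0 -> half_der_symbol k c -> c (- k) = 0 ->
  forall m, m != 0 -> c m = 0.
Proof.
move=> k0 cP cNk.
have n2 : 2 != 0 :> K by rewrite pnatr_eq0.
pose Q := q ^ (k.1 * k.2).
have Q0 : Q != 0 by exact: expfz_neq0.
pose S m := q ^ (m.2 * k.1) + q ^ (m.1 * k.2).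
have SD m : S (m + k) = Q * S m.
  by rewrite /S /Q /= !mulrDl !expfzDr // (mulrC k.2); ring.
have step m : det2 m k != 0 -> c (m + k) = 2 * Q * c m.
  move=> mk.
  have l0 : lambda q (m + k) (- k) != 0.
    by rewrite lambda_eq0 det2Nr oppr_eq0 det2Dl det2xx addr0.
  have := cP (m + k) (- k); rewrite cNk addrK mulr0 addr0.
  rewrite (lambda_shiftr (m + k)).
  move=> h; apply: (mulfI l0).
  have -> : lambda q (m + k) (- k) * (2 * Q * c m) =
      2 * Q * (lambda q (m + k) (- k) * c m) by ring.
  by rewrite h -/Q; field.
have dbl m : det2 m k != 0 -> 3 * Q * c m = c k * S m.
  move=> mk.
  have l0 : lambda q m k != 0 by rewrite lambda_eq0.
  have := cP m k; rewrite lambda_shiftl lambda_double -/(S m) -/Q step //.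
  move/(congr1 ( *%R 2)); rewrite mulVKf // => h; apply: (mulfI l0).
  have -> : lambda q m k * (3 * Q * c m) =
      2 * (lambda q m k * (2 * Q * c m)) - Q * lambda q m k * c m by ring.
  by rewrite h; ring.
have off m : det2 m k != 0 -> c m = 0.
  move=> mk; have mkk : det2 (m + k) k != 0 by rewrite det2Dl det2xx addr0.
  have := dbl _ mkk; rewrite step // SD => h.
  have n3 : 3 != 0 :> K by rewrite pnatr_eq0.
  have : 3 * Q * Q * c m = 0.
    have -> : 3 * Q * Q * c m = 3 * Q * (2 * Q * c m) - Q * (3 * Q * c m).
      by ring.
    by rewrite h (dbl _ mk); ring.
  by move/eqP; rewrite !mulf_eq0 (negbTE n3) (negbTE Q0) /= => /eqP.
(* On the line of [k], split [m = (m - n) + n] with both terms off it. *)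
move=> m m0; have [/eqP mk|/off//] := boolP (det2 m k == 0).
have [n [mn kn]] := exists_off_two_lines m0 k0.
have nk : det2 n k != 0 by rewrite det2C oppr_eq0.
have mnk : det2 (m - n) k != 0.
  by rewrite det2Dl mk add0r det2C det2Nr opprK.
have l0 : lambda q (m - n) n != 0.
  by rewrite lambda_eq0 det2Dl (det2C n (- n)) det2Nr det2xx !oppr0 addr0.
apply: (mulfI l0); have := cP (m - n) n.
by rewrite subrK (off _ nk) (off _ mnk) => ->; rewrite !mulr0 addr0 mulr0.
Qed.

End Symbol.

(** * Homogeneous components of half-derivations *)

Section Coefficients.
Variables (K : numFieldType) (q : K) (q0 : q != 0).

Local Notation V := (Vq q0).
Local Notation L := (L q0).

(** Extended by zero to the zero vector, in accordance with [L 0 = 0]: with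
this value the formulas for brackets below hold for all vectors. *)
Definition coef (p : int * int) (x : V) : K :=
  if insub p is Some k then mcoeff (k : idx) x else 0.

Lemma coef0 x : coef 0 x = 0.
Proof. by rewrite /coef insubF // eqxx. Qed.

Lemma coef_linear p : linear (coef p : V -> K^o).
Proof.
move=> a x y; rewrite /coef; case: insubP => [k _ _|_].
  by rewrite mcoeffD mcoeffZ.
by rewrite scaler0 addr0.
Qed.

Lemma coefD p x y : coef p (x + y) = coef p x + coef p y.
Proof. by have := coef_linear p 1 x y; rewrite !scale1r. Qed.

Lemma coefZ p a x : coef p (a *: x) = a * coef p x.
Proof.
rewrite /coef; case: insubP => [k _ _|_]; first by rewrite mcoeffZ.
by rewrite mulr0.
Qed.

Lemma coefL p m : p != 0 -> coef p (L m) = (m == p)%:R.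
Proof.
move=> p0; rewrite /coef insubT /=.
have [->|m0] := eqVneq m 0; first by rewrite L0 mcoeff0 eq_sym (negbTE p0).
by rewrite -[m]/(\val (exist _ m m0 : idx)) L_val mcoeffU.
Qed.

Lemma coef_ext x y : (forall p, p != 0 -> coef p x = coef p y) -> x = y.
Proof.
move=> xy; apply/malgP => k.
by have := xy _ (valP k); rewrite /coef valK.
Qed.

(** Bracketing with [L n] translates the degree by [n], so a single coefficient
of [x] contributes. *)
Lemma coef_lieL p n x :
  coef p (lie x (L n)) = lambda q (p - n) n * coef (p - n) x.
Proof.
apply/eqP; rewrite -subr_eq0; apply/eqP.
pose g x : K^o := coef p (lie x (L n)) - lambda q (p - n) n * coef (p - n) x.
apply: (@linear_ext0 _ _ _ g x) => [a u v|k].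
  rewrite /g lie_linearl !coef_linear /=.
  by rewrite -![_ *: _]/(_ * _); ring.
rewrite /g -L_val lieLL coefZ.
(* The cases [p = n] and [p = 0] involve the value of [coef] at zero; there
   both sides vanish. *)
have [pn|pn0] := eqVneq (p - n) 0.
  move/eqP: (pn); rewrite subr_eq0 => /eqP pE.
  rewrite pn lambda0l mul0r subr0.
  have [n0|n0] := eqVneq n 0; first by rewrite n0 lambda0r mul0r.
  rewrite coefL ?pE // -subr_eq0 addrK.
  by rewrite (negbTE (valP k)) mulr0.
rewrite (coefL _ pn0).
have [p0|p0] := eqVneq p 0.
  rewrite p0 coef0 mulr0 !sub0r.
  case: eqP => _; last by rewrite mulr0 oppr0.
  by rewrite /lambda /= !mulNr (mulrC n.1) subrr mul0r oppr0.
rewrite coefL // eq_sym -subr_eq (eq_sym (p - n)).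
by case: eqP => [->|_]; rewrite ?mulr0 subrr.
Qed.

Lemma lieC (x y : V) : lie x y = - lie y x.
Proof. by apply/eqP; rewrite -addr_eq0; apply/eqP/bracketC. Qed.

Lemma coef_Llie p n x :
  coef p (lie (L n) x) = lambda q n (p - n) * coef (p - n) x.
Proof.
rewrite lieC -scaleN1r coefZ coef_lieL /lambda (mulrC n.2) (mulrC n.1).
by ring.
Qed.

(** The equation is the coefficient at [m + n + k] of the half-derivation rule
for [L m] and [L n].  It holds without nondegeneracy conditions on [m], [n] and
[k], thanks to the convention [coef 0 x = 0]. *)
Lemma half_der_symbolP (phi : V -> V) k : half_derivation phi ->
  half_der_symbol q k (fun m => coef (m + k) (phi (L m))).
Proof.
move=> [phiL phiD] m n.
have phi0 : phi 0 = 0.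
  by have := phiL (-1) 0 0; rewrite scaler0 addr0 scaleN1r addNr.
have := congr1 (coef (m + n + k)) (phiD (L m) (L n)).
rewrite lieLL; have := phiL (lambda q m n) (L (m + n)) 0.
rewrite phi0 !addr0 => ->; rewrite !coefZ coefD coef_lieL coef_Llie => ->.
have -> : m + n + k - n = m + k by rewrite -!addrA (addrC k) addNKr.
by have -> : m + n + k - m = n + k by rewrite -!addrA addrC -addrA addrNK.
Qed.

Lemma half_derivation_scalar (a : K) : half_derivation (fun x : V => a *: x).
Proof.
split=> [b x y|x y]; first by rewrite scalerDr !scalerA mulrC.
rewrite -[lie (a *: x) y]/(bracket _ _) -[lie x (a *: y)]/(bracket _ _).
rewrite bracketZl bracketZr -scalerDr -mulr2n -scaler_nat !scalerA.
by rewrite mulrCA mulVf ?mulr1 // pnatr_eq0.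
Qed.

Hypothesis q_nroot : forall t : nat, (0 < t)%N -> q ^+ t != 1.

(** The diagonal coefficient of [phi (L m)] is constant in [m] and the others
vanish; the scalar can be read off at any nonzero vector, here [(1, 0)]. *)
Lemma half_derivation_is_scalar (phi : V -> V) : half_derivation phi ->
  exists a, phi = fun x => a *: x.
Proof.
move=> phiP; pose e : int * int := (1, 0).
have e0 : e != 0 by [].
exists (coef e (phi (L e))); set a := coef _ _.
have phiL m : m != 0 -> phi (L m) = a *: L m.
  move=> m0; apply: coef_ext => p p0; rewrite coefZ coefL //.
  have [<-|mp] := eqVneq m p.
    have := symbol_shift0 q0 q_nroot (half_der_symbolP 0 phiP) m0 e0.
    by rewrite !addr0 mulr1.
  have k0 : p - m != 0 by rewrite subr_eq0 eq_sym.
  have := symbol_shift_neq0 q0 q_nroot k0 (half_der_symbolP (p - m) phiP).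
  by rewrite addNr coef0 mulr0 => /(_ erefl m m0); rewrite addrC subrK.
apply/funext => x; apply/eqP; rewrite -subr_eq0; apply/eqP.
apply: (@linear_ext0 _ _ _ (fun x : V => phi x - a *: x) x) => [b u v|k].
  rewrite (phiP.1 b u v) scalerDr !scalerA (mulrC a) opprD addrACA scalerBr.
  by rewrite scalerA.
by rewrite -L_val phiL ?subrr // (valP k).
Qed.

End Coefficients.

Theorem theorem3p1 (R : realType) (q : R[i]) (q0 : q != 0)
    (q_nroot : forall t : nat, (0 < t)%N -> q ^+ t != 1) :
  Delta (Vq q0) = lspan [set @idfun (Vq q0)].
Proof.
apply/seteqP; split=> [phi|phi].
  case/(half_derivation_is_scalar q_nroot) => a ->.
  exists 1, (fun=> a), (fun=> idfun); split=> //.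
  by rewrite big_ord1.
case=> n [c [u [uid ->]]].
have -> : \sum_i c i *: u i = fun x => (\sum_i c i) *: x.
  apply/funext => x; rewrite fct_sumE scaler_suml.
  by apply: eq_bigr => i _; rewrite (uid i).
exact: half_derivation_scalar.
Qed.
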